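(* Suppose the entries of $A\in\mathbb{Z}_2^{k\times n}$ are drawn uniformly and independently at random, where $k\in\left[4\log_2 n,\ \frac12\sqrt{n\ln2}\right]$. Then $M(A)=\left(n/k^2\right)^{\Omega(k)}$ with probability $\Omega(1)$ over $A$. That is, there are constants $c,c'>0$ such that for all sufficiently large $n$ and all integers $k$ in the stated range, $\Pr_A\left[M(A)\ge (n/k^2)^{ck}\right]\ge c'$.
   Context: For $A\in\mathbb{Z}_2^{k\times n}$, $M(A)=\mathrm{MOTS}(|C\rangle)$, where $C=\{x\in\mathbb{Z}_2^n: Ax\equiv b\}$ for any $b\in\mathbb{Z}_2^k$ such that $Ax\equiv b$ is solvable (the value does not depend on the choice of such $b$), and $|C\rangle=\frac{1}{\sqrt{|C|}}\sum_{x\in C}|x\rangle$. A quantum state tree over $(\mathbb{C}^2)^{\otimes n}$ is a rooted tree in which each leaf is labeled with $\alpha|0\rangle+\beta|1\rangle$ for some $\alpha,\beta\in\mathbb{C}$, each non-leaf vertex (gate, of arbitrary fan-in) is labeled with $+$ or $\otimes$, and each vertex $v$ is labeled with a set $S(v)\subseteq\{1,\dots,n\}$ (of qubits) such that: (i) $|S(v)|=1$ if $v$ is a leaf; (ii) $S(v)=\{1,\dots,n\}$ if $v$ is the root; (iii) if $v$ is a $+$ gate and $w$ is a child of $v$ then $S(w)=S(v)$; (iv) if $v$ is a $\otimes$ gate with children $w_1,\dots,w_k$ then $S(w_1),\dots,S(w_k)$ form a partition of $S(v)$. The outgoing edges of each $+$ gate are labeled with complex numbers. The subtree at $v$ represents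 a state of the qubits in $S(v)$ in the obvious way (linear combination with edge labels as coefficients, respectively tensor product), required to be normalized for every $v$. The tree is manifestly orthogonal if for every $+$ gate and any two of its children, representing $|\psi_1\rangle,|\psi_2\rangle$, every basis state $|x\rangle$ has $\langle\psi_1|x\rangle=0$ or $\langle\psi_2|x\rangle=0$. $\mathrm{MOTS}(|\psi\rangle)$ is the minimum number of leaves of a manifestly orthogonal tree representing $|\psi\rangle$. *)

(* Defs.v *)
From HB Require Import structures.
From mathcomp Require Import all_boot all_order all_algebra.
From mathcomp Require Import complex.
From mathcomp Require Import boolp reals exp.

Set Implicit Arguments.
Unset Strict Implicit.
Unset Printing Implicit Defensive.

Import Order.TTheory GRing.Theory Num.Theory.
Local Open Scope ring_scope.
Local Open Scope complex_scope.

(* Bit strings are column vectors over 'F_2, so that [x i 0] is the i-th bit. *)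
Notation bits n := 'cV['F_2]_n.

(* The vertex labels S(v) are stored in the tree, except that a leaf carries   *)
(* its unique qubit; [qtree] itself imposes no consistency condition.          *)
Inductive qtree (R : realType) (n : nat) : Type :=
| Leaf (i : 'I_n) (alpha beta : R[i])
| Plus (Q : {set 'I_n}) (m : nat) (a : 'I_m -> R[i]) (w : 'I_m -> qtree R n)
| Tensor (Q : {set 'I_n}) (m : nat) (w : 'I_m -> qtree R n).

Arguments Leaf {R n} i alpha beta.
Arguments Plus {R n} Q {m} a w.
Arguments Tensor {R n} Q {m} w.

Section Trees.
Variables (R : realType) (n : nat).
Implicit Types (t : qtree R n) (Q : {set 'I_n}) (x y v : bits n).

Definition qubits t : {set 'I_n} :=
  match t with
  | Leaf i _ _ => [set i]
  | Plus Q _ _ _ => Q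
  | Tensor Q _ _ => Q
  end.

Fixpoint leaves t : nat :=
  match t with
  | Leaf _ _ _ => 1
  | Plus _ m _ w => \sum_(j < m) leaves (w j)
  | Tensor _ m w => \sum_(j < m) leaves (w j)
  end%N.

(* Amplitude of |x> in the state represented by t. In a well-labelled tree    *)
(* only the bits of x in [qubits t] matter (lemma [amp_local]), so a basis     *)
(* state of the qubits in Q is encoded below by the bit string that extends it *)
(* by 0 outside Q.                                                             *)
Fixpoint amp t x : R[i] :=
  match t with
  | Leaf i alpha beta => if x i 0 == 0 then alpha else beta
  | Plus _ m a w => \sum_(j < m) a j * amp (w j) x
  | Tensor _ m w => \prod_(j < m) amp (w j) x
  end.

Definition basis Q : {set bits n} :=
  [set x : bits n | [forall i, (i \notin Q) ==> (x i 0 == 0)]].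

Fixpoint every_vertex (P : qtree R n -> Prop) t : Prop :=
  P t /\
  match t with
  | Leaf _ _ _ => True
  | Plus _ _ _ w => forall j, every_vertex P (w j)
  | Tensor _ _ w => forall j, every_vertex P (w j)
  end.

(* Gates have at least one child, a childless vertex being a leaf. As          *)
(* [partition] concerns the set of blocks, injectivity is needed to express    *)
(* that distinct children have disjoint labels.                                *)
Definition well_labelled t : Prop :=
  match t with
  | Leaf _ _ _ => True
  | Plus Q m _ w => (0 < m)%N /\ forall j, qubits (w j) = Q
  | Tensor Q m w =>
      [/\ (0 < m)%N, injective (fun j => qubits (w j))
        & partition [set qubits (w j) | j : 'I_m] Q]
  end.

Definition normalized t : Prop :=
  \sum_(x in basis (qubits t)) `|amp t x| ^+ 2 = 1.

Definition state_tree t : Prop :=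
  [/\ qubits t = [set: 'I_n], every_vertex well_labelled t
    & every_vertex normalized t].

Definition disjoint_children t : Prop :=
  match t with
  | Plus Q m _ w => forall i j : 'I_m, i != j ->
      forall x, x \in basis Q -> amp (w i) x = 0 \/ amp (w j) x = 0
  | _ => True
  end.

Definition manifestly_orthogonal t : Prop := every_vertex disjoint_children t.

Definition represents t (psi : bits n -> R[i]) : Prop :=
  forall x, amp t x = psi x.

Definition mot_size (psi : bits n -> R[i]) : pred nat := fun s =>
  `[< exists t, [/\ state_tree t, manifestly_orthogonal t, represents t psi
                  & leaves t = s] >].

(* The value 0 is a dummy, taken only if no tree represents psi; this does not *)
(* happen for n > 0 and psi of norm 1 (lemma [mot_exists]).                    *)
Definition MOTS (psi : bits n -> R[i]) : nat :=
  if pselect (exists s, mot_size psi s) is left e then ex_minn e else 0%N.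

End Trees.

Definition solution_set (k n : nat) (A : 'M['F_2]_(k, n)) (b : 'cV['F_2]_k) :
  {set bits n} := [set x | A *m x == b].

Definition uniform_state (R : realType) (n : nat) (C : {set bits n}) :
    bits n -> R[i] :=
  fun x => if x \in C then ((Num.sqrt (#|C|%:R : R))^-1)%:C else 0.

(* M(A), computed with b = 0; any solvable b gives the same value (lemma       *)
(* [M_solvable]).                                                              *)
Definition M (R : realType) (k n : nat) (A : 'M['F_2]_(k, n)) : nat :=
  MOTS (@uniform_state R n (solution_set A 0)).

Definition PrA (R : realType) (k n : nat) (E : pred 'M['F_2]_(k, n)) : R :=
  \sum_(A | E A) \prod_(i < k) \prod_(j < n) (#|{: 'F_2}|%:R)^-1.

Definition log2 (R : realType) (x : R) : R := ln x / ln 2.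

Section Facts.
Variables (R : realType) (n : nat).
Implicit Types (t : qtree R n) (Q : {set 'I_n}) (x y v : bits n).

Lemma basisP Q x : reflect (forall i, i \notin Q -> x i 0 = 0) (x \in basis Q).
Proof.
rewrite inE; apply: (iffP forallP) => [H i iS|H i].
  by have /implyP/(_ iS)/eqP := H i.
by apply/implyP => iS; rewrite H.
Qed.

Lemma amp_local t x y : every_vertex (@well_labelled R n) t ->
  (forall i, i \in qubits t -> x i 0 = y i 0) -> amp t x = amp t y.
Proof.
elim: t => [i a b|Q m a w IH|Q m w IH] /=.
- by move=> _ /(_ i (set11 i)) ->.
- move=> [[_ qS] wl] xy; apply: eq_bigr => j _; congr (_ * _).
  by apply: IH => // i; rewrite qS; apply: xy.
- move=> [[_ _ /and3P[/eqP cov _ _]] wl] xy; apply: eq_bigr => j _.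
  apply: IH => // i ij; apply: xy; rewrite -cov.
  by apply/bigcupP; exists (qubits (w j)) => //; apply: imset_f.
Qed.

Fixpoint flip (y : bits n) t : qtree R n :=
  match t with
  | Leaf i a b => if y i 0 == 0 then Leaf i a b else Leaf i b a
  | Plus Q m a w => Plus Q a (fun j => flip y (w j))
  | Tensor Q m w => Tensor Q (fun j => flip y (w j))
  end.

Lemma qubits_flip y t : qubits (flip y t) = qubits t.
Proof. by case: t => //= i a b; case: ifP. Qed.

Lemma leaves_flip y t : leaves (flip y t) = leaves t.
Proof.
elim: t => [i a b|Q m a w IH|Q m w IH] /=; first by case: ifP.
- by apply: eq_bigr => j _; rewrite IH.
- by apply: eq_bigr => j _; rewrite IH.
Qed.

Lemma amp_flip y t x : amp (flip y t) x = amp t (x + y).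
Proof.
elim: t => [i a b|Q m a w IH|Q m w IH] /=.
- have F2 (u v : 'F_2) : (if v == 0 then (if u == 0 then a else b)
    else (if u == 0 then b else a)) = (if u + v == 0 then a else b).
    by case: u => [[|[|u]] //=] ?; case: v => [[|[|v]] //=] ?.
  by rewrite mxE -F2; case: (y i 0 == 0).
- by apply: eq_bigr => j _; rewrite IH.
- by apply: eq_bigr => j _; rewrite IH.
Qed.

Definition restrict Q x : bits n := \col_i (if i \in Q then x i 0 else 0).

Lemma restrict_basis Q x y : (x + restrict Q y \in basis Q) = (x \in basis Q).
Proof.
apply/basisP/basisP => H i iS; have := H i iS;
  by rewrite !mxE (negbTE iS) addr0.
Qed.

Lemma amp_restrict t x y : every_vertex (@well_labelled R n) t ->
  amp t (x + y) = amp t (x + restrict (qubits t) y).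
Proof. by move=> wl; apply: amp_local => // i iS; rewrite !mxE iS. Qed.

Lemma flip_well_labelled y t : every_vertex (@well_labelled R n) t ->
  every_vertex (@well_labelled R n) (flip y t).
Proof.
elim: t => [i a b|Q m a w IH|Q m w IH] /=; first by case: ifP.
- move=> [[m0 qS] wl]; split; last by move=> j; apply: IH.
  by split=> // j; rewrite qubits_flip.
- move=> [[m0 inj par] wl]; split; last by move=> j; apply: IH.
  split=> // [i j|]; first by rewrite !qubits_flip; apply: inj.
  by under eq_imset => j do rewrite qubits_flip.
Qed.

Lemma normalized_flip y t : every_vertex (@well_labelled R n) t ->
  normalized t -> normalized (flip y t).
Proof.
move=> wl; rewrite /normalized qubits_flip => <-.
rewrite [RHS](reindex_inj (addIr (restrict (qubits t) y))) /=.
apply: eq_big => [x|x _]; first by rewrite restrict_basis.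
by rewrite amp_flip amp_restrict.
Qed.

Lemma every_normalized_flip y t : every_vertex (@well_labelled R n) t ->
  every_vertex (@normalized R n) t -> every_vertex (@normalized R n) (flip y t).
Proof.
elim: t => [i a b|Q m a w IH|Q m w IH].
- move=> wl [nt _]; have := normalized_flip y wl nt.
  by rewrite /=; case: ifP.
- move=> wl [nt ns]; split; first exact: (normalized_flip y wl nt).
  by move=> j; apply: IH; [exact: (proj2 wl)|exact: ns].
- move=> wl [nt ns]; split; first exact: (normalized_flip y wl nt).
  by move=> j; apply: IH; [exact: (proj2 wl)|exact: ns].
Qed.

Lemma flip_manifestly_orthogonal y t : every_vertex (@well_labelled R n) t ->
  manifestly_orthogonal t -> manifestly_orthogonal (flip y t).
Proof.
rewrite /manifestly_orthogonal.
elim: t => [i a b|Q m a w IH|Q m w IH] /=; first by case: ifP.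
- move=> [[_ qS] wl] [mo ms]; split; last by move=> j; apply: IH.
  move=> i j ij x xS; rewrite !amp_flip (amp_restrict _ _ (wl i)).
  by rewrite (amp_restrict _ _ (wl j)) !qS; apply: mo; rewrite ?restrict_basis.
- by move=> [_ wl] [_ ms]; split=> // j; apply: IH.
Qed.

Lemma mot_size_flip y (psi phi : bits n -> R[i]) s :
  (forall x, phi x = psi (x + y)) -> mot_size psi s -> mot_size phi s.
Proof.
move=> psiphi /asboolP[t [[qt wl nt] mo rep <-]]; apply/asboolP.
exists (flip y t); split.
- split; rewrite ?qubits_flip //; first exact: flip_well_labelled.
  exact: every_normalized_flip.
- exact: flip_manifestly_orthogonal.
- by move=> x; rewrite amp_flip rep psiphi.
- exact: leaves_flip.
Qed.

Lemma eq_MOTS (psi phi : bits n -> R[i]) :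
  mot_size psi =1 mot_size phi -> MOTS psi = MOTS phi.
Proof. by move=> /funext h; rewrite /MOTS h. Qed.

Lemma M_solvable k (A : 'M['F_2]_(k, n)) b : (exists x, A *m x = b) ->
  MOTS (@uniform_state R n (solution_set A b)) = M R A.
Proof.
move=> [x0 Ax0]; apply: eq_MOTS => s.
have card : #|solution_set A b| = #|solution_set A 0|.
  rewrite -(card_imset (mem (solution_set A 0)) (addIr x0)).
  apply: eq_card => x; rewrite inE; apply/eqP/imsetP => [Ax|[z]].
    exists (x - x0); rewrite ?subrK // inE.
    by rewrite mulmxBr Ax Ax0 subrr.
  by rewrite inE => /eqP Az ->; rewrite mulmxDr Az Ax0 add0r.
have shift x : uniform_state R (solution_set A 0) x
    = uniform_state R (solution_set A b) (x + x0).
  by rewrite /uniform_state card !inE mulmxDr Ax0 -[X in _ + _ == X]add0r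
    (inj_eq (addIr b)).
apply/idP/idP; first exact: (mot_size_flip shift).
apply: (@mot_size_flip (- x0)) => x.
by rewrite shift subrK.
Qed.

Definition bit_tree (v : bits n) (i : 'I_n) : qtree R n :=
  Leaf i (v i 0 == 0)%:R (v i 0 != 0)%:R.

Definition point_tree (v : bits n) : qtree R n :=
  Tensor [set: 'I_n] (bit_tree v).

Definition sum_tree (psi : bits n -> R[i]) : qtree R n :=
  Plus [set: 'I_n] (fun j : 'I_#|{: bits n}| => psi (enum_val j))
    (fun j => point_tree (enum_val j)).

Lemma basisT : basis [set: 'I_n] = [set: bits n].
Proof. by apply/setP => x; rewrite in_setT; apply/basisP => i; rewrite in_setT. Qed.

Lemma amp_bit_tree v i x : amp (bit_tree v i) x = (x i 0 == v i 0)%:R.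
Proof.
rewrite /=; move: (x i 0) (v i 0) => a b.
by case: a => [[|[|a]] //=] ?; case: b => [[|[|b]] //=] ?.
Qed.

Lemma amp_point_tree v x : amp (point_tree v) x = (x == v)%:R.
Proof.
rewrite -[LHS]/(\prod_(i < n) amp (bit_tree v i) x).
have [->|xv] := eqVneq x v.
  by rewrite big1 // => i _; rewrite amp_bit_tree eqxx.
have [i xvi] : exists i, x i 0 != v i 0.
  apply/existsP; apply: contra_neqT xv; rewrite negb_exists => /forallP h.
  by apply/colP => i; apply/eqP; have := h i; rewrite negbK.
by rewrite (bigD1 i) // amp_bit_tree (negbTE xvi) /= mul0r.
Qed.

Lemma amp_sum_tree psi x : amp (sum_tree psi) x = psi x.
Proof.
rewrite -[LHS]/(\sum_j psi (enum_val j) * amp (point_tree (enum_val j)) x).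
under eq_bigr => j _ do rewrite amp_point_tree.
rewrite (bigD1 (enum_rank x)) //= enum_rankK eqxx mulr1 big1 ?addr0 // => j jx.
case: eqVneq => [xj|]; last by rewrite mulr0.
by rewrite xj enum_valK eqxx in jx.
Qed.

Lemma normalized_bit_tree v i : normalized (bit_tree v i).
Proof.
rewrite /normalized (bigD1 (restrict [set i] v)); last first.
  by apply/basisP => j; rewrite !mxE => /negbTE ->.
rewrite amp_bit_tree !mxE set11 eqxx normr1 expr1n /= big1 ?addr0 // => x.
case/andP => /basisP bx xv; rewrite -[X in `|X|]/(amp (bit_tree v i) x) amp_bit_tree.
case: eqP => [xi|]; last by rewrite normr0 expr0n.
case/negP: xv; apply/eqP/colP => j; rewrite !mxE.
by case: ifPn => [/set1P -> //|]; apply: bx.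
Qed.

Lemma normalized_point_tree v : normalized (point_tree v).
Proof.
rewrite /normalized [qubits _]/= basisT.
rewrite (bigD1 v) ?inE //= -[X in `|X|]/(amp (point_tree v) v).
rewrite amp_point_tree eqxx normr1 expr1n big1 ?addr0 // => x /andP[_ xv].
rewrite -[X in `|X|]/(amp (point_tree v) x) amp_point_tree (negbTE xv).
by rewrite normr0 expr0n.
Qed.

Lemma mot_exists (psi : bits n -> R[i]) : (0 < n)%N ->
  \sum_x `|psi x| ^+ 2 = 1 -> exists s, mot_size psi s.
Proof.
move=> n0 psi1; exists (leaves (sum_tree psi)); apply/asboolP.
exists (sum_tree psi); split=> //; last exact: amp_sum_tree.
  split=> //; split=> //.
  - split=> [|j //]; apply/card_gt0P; by exists 0.
  - move=> j; split=> //; split=> //; first exact: set1_inj.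
    apply/and3P; split.
    + rewrite eqEsubset subsetT; apply/subsetP => i _.
      by apply/bigcupP; exists [set i]; rewrite ?set11 ?imset_f.
    + apply/trivIsetP => _ _ /imsetP[a _ ->] /imsetP[b _ ->] /= ab.
      by rewrite disjoints1 inE; apply: contra_neqN ab => /eqP ->.
    + apply/imsetP => -[i _ e].
      by have := set11 i; rewrite -[[set i]]e inE.
  - rewrite /normalized [qubits _]/= basisT -psi1.
    apply: eq_big => [x|x _]; first by rewrite in_setT.
    by rewrite -(amp_sum_tree psi x).
  - move=> j; split; first exact: normalized_point_tree.
    by move=> i; split=> //; apply: normalized_bit_tree.
split=> [i j ij x _|j]; last by split=> // i; split.
rewrite !amp_point_tree; case: (eqVneq x (enum_val i)) => [->|_]; last by left.
by right; rewrite (inj_eq enum_val_inj) (negbTE ij).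
Qed.

End Facts.

(* Main.v *)
(* Let h(B) be the number of vectors A x with x supported on B. If a tree on   *)
(* the qubits Q has its support inside a coset of ker A, the support has at    *)
(* most 2^|Q| / h(Q) elements. Follow a path down the tree: at a + gate the    *)
(* supports of the children add up, and at a (x) gate all but one child can be *)
(* bounded in this trivial way. Peeling off always the smallest sibling, the   *)
(* sets removed along the path are merged (h is submultiplicative) until they  *)
(* make up half of the current qubits; each such merged set costs a factor 2^r *)
(* if every set of s columns of A has rank at least r. The qubits shrink by a  *)
(* factor at most 4 in each round, so a tree for ker A has at least            *)
(* 2^(j r - k) leaves if s 4^j <= n. For s = k and r = k / 4, there are at     *)
(* most 2^(2 k r) square matrices of size k and rank at most r, and a union    *)
(* bound over n^k <= 2^(k^2 / 4) choices of columns shows that the rank        *)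
(* condition holds with probability at least 1/2.                              *)

Require Import Defs.
From mathcomp Require Import all_boot all_order all_algebra.
From mathcomp Require Import complex.
From mathcomp Require Import boolp reals exp.
From mathcomp Require Import zify lra.

Set Implicit Arguments.
Unset Strict Implicit.
Unset Printing Implicit Defensive.

Import Order.TTheory GRing.Theory Num.Theory.
Local Open Scope ring_scope.

(** Write h(B) for [#|img A B|]. Inside a coset of the kernel of A, a set of vectors supported on B
    falls short of 2^|B| by a factor h(B) ([card_fiber_img]), and every child of a tensor gate
    inherits the coset condition. Manifest orthogonality excludes cancellation, so the children of a
    + gate inherit it too. The invariant [cost_bound] turns these losses into a lower bound on
    leaves: it is additive in support size and leaf count, which settles + gates, and
    [cost_bound_setU] with [cost_bound_bigcup] settles tensor gates. The induction is
    [tree_cost_bound]; at the root, with a kernel of size at least 2^(n - k), it yields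
    [MOTS_lower_bound].

    For random A, [card_degenerate] and [half_nondegenerate] count the matrices with k columns of
    low rank, and [img_nondegenerate] turns the absence of such columns into a lower bound on h.
    With r near k/4 and 4^j near n/k, the exponent j r - k has order k log(n/k). *)

(** * Vectors supported on a set of qubits and their images under A *)

Section Basis.
Variable n : nat.
Implicit Types (Q D B : {set 'I_n}) (x y : bits n).

Lemma basisD Q x y : x \in basis Q -> y \in basis Q -> x + y \in basis Q.
Proof.
by move=> /basisP hx /basisP hy; apply/basisP => i iQ; rewrite mxE hx // hy // addr0.
Qed.

Lemma restrict_in_basis Q x : Defs.restrict Q x \in basis Q.
Proof. by apply/basisP => i iQ; rewrite mxE (negbTE iQ). Qed.

Lemma card_basis_le Q : (#|basis Q| <= 2 ^ #|Q|)%N.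
Proof.
apply: (@leq_trans #|pffun_on (0 : 'F_2) (mem Q) predT|); last first.
  by rewrite card_pffun_on card_Fp.
have inj : injective (fun x : bits n => [ffun i => x i 0]).
  by move=> x y /ffunP e; apply/colP => i; have := e i; rewrite !ffunE.
rewrite -(card_imset _ inj); apply/subset_leq_card/subsetP => _ /imsetP[x xQ ->].
apply/pffun_onP; split; last by [].
apply/subsetP => i; rewrite inE ffunE; apply: contraNT => iQ.
by rewrite (basisP _ _ xQ).
Qed.

End Basis.

Section Image.
Variables (k n : nat) (A : 'M['F_2]_(k, n)).
Implicit Types (Q D B : {set 'I_n}) (x y : bits n).

Definition img Q : {set 'cV['F_2]_k} := [set A *m x | x in basis Q].

Lemma img_gt0 Q : (0 < #|img Q|)%N.
Proof.
apply/card_gt0P; exists (A *m 0); apply: imset_f.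
by apply/basisP => i _; rewrite mxE.
Qed.

Lemma card_img_le Q : (#|img Q| <= 2 ^ #|Q|)%N.
Proof. exact: leq_trans (leq_imset_card _ _) (card_basis_le Q). Qed.

Lemma card_imgU D B : (#|img (D :|: B)| <= #|img D| * #|img B|)%N.
Proof.
rewrite -cardsX.
pose add (u : 'cV['F_2]_k * 'cV['F_2]_k) := u.1 + u.2.
apply: leq_trans (leq_imset_card add (mem (setX (img D) (img B)))).
apply/subset_leq_card/subsetP => _ /imsetP[x /basisP xDB ->].
apply/imsetP; exists (A *m Defs.restrict D x, A *m (x - Defs.restrict D x)) => /=.
  rewrite inE /= !imset_f ?restrict_in_basis //.
  apply/basisP => i iB; rewrite !mxE; case: ifPn => [_|iD]; first by rewrite subrr.
  by rewrite xDB ?subr0 // in_setU negb_or iD.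
by rewrite /add /= -mulmxDr addrC subrK.
Qed.

(** Choose a preimage of each vector in [img A Q]. The translates of S by these preimages stay in
    [basis Q] and are pairwise disjoint, because A is constant on each with a different value. *)
Lemma card_fiber_img (S : {set bits n}) Q : S \subset basis Q ->
  {in S &, forall x y, A *m x = A *m y} -> (#|S| * #|img Q| <= 2 ^ #|Q|)%N.
Proof.
move=> /subsetP SQ cS; apply: leq_trans (card_basis_le Q).
rewrite -cardsX.
pose lift v : bits n := odflt 0 [pick y in basis Q | A *m y == v].
have liftP v : v \in img Q -> lift v \in basis Q /\ A *m lift v = v.
  move=> /imsetP[y yQ ->]; rewrite /lift; case: pickP => [z /andP[zQ /eqP //]|].
  by move/(_ y); rewrite yQ eqxx.
rewrite -(@card_in_imset _ _ (fun u => u.1 + lift u.2)).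
  apply/subset_leq_card/subsetP => _ /imsetP[[x v] /setXP[xS vQ] ->] /=.
  by apply: basisD; [exact: SQ|case: (liftP v vQ)].
move=> [x v] [y u] /setXP[/= xS vQ] /setXP[/= yS uQ] e.
have [_ lv] := liftP v vQ; have [_ lu] := liftP u uQ.
have euv : v = u.
  have := congr1 (mulmx A) e; rewrite !mulmxDr lv lu (cS x y) //.
  exact: addrI.
by move: e; rewrite euv => /addIr ->.
Qed.

End Image.

(** * The invariant relating support size to leaf count *)

Section CostBound.
Variables (k n : nat) (A : 'M['F_2]_(k, n)) (s r : nat).
Hypothesis s_gt0 : (0 < s)%N.
Hypothesis large_img : forall B : {set 'I_n}, (s <= #|B|)%N -> (2 ^ r <= #|img A B|)%N.
Implicit Types (Q D B : {set 'I_n}).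

(* D collects the sets peeled off since the last factor 2^r was gained, and j  *)
(* bounds the number of factors still to be gained.                            *)
Definition cost_bound Q (N L : nat) := forall D j, [disjoint Q & D] ->
  (#|D| <= #|Q|)%N -> (j = 0 \/ s * 4 ^ j <= #|Q| + #|D|)%N ->
  (N * 2 ^ (j * r) <= L * 2 ^ #|Q| * #|img A D|)%N.

(** Here Q and D have at most two elements together, fewer than s * 4, so only j = 0 is
    admissible. *)
Lemma cost_bound_leaf i N : (N <= 2)%N -> cost_bound [set i] N 1.
Proof.
move=> N2 D [|j] _; rewrite cards1 => D1; last first.
  by case=> //; rewrite expnS; have := expn_gt0 4 j; nia.
by move=> _; rewrite mul0n muln1; have := img_gt0 A D; nia.
Qed.

(** B is the smaller part of a tensor gate; it is bounded trivially and its leaves are ignored.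
    Either B joins D, at a cost controlled by submultiplicativity of h, or D and B together outgrow
    Q and are traded for one factor 2^r, after which D restarts from the empty set. *)
Lemma cost_bound_setU Q B N L N' L' : [disjoint Q & B] -> (#|B| <= #|Q|)%N ->
  (N' * #|img A B| <= 2 ^ #|B|)%N -> (L <= L')%N -> cost_bound Q N L ->
  cost_bound (Q :|: B) (N' * N) L'.
Proof.
move=> dQB BQ NB LL cQ D j dD DQ hj.
have cQB : #|Q :|: B| = (#|Q| + #|B|)%N by rewrite cardsU disjoint_setI0 // cards0 subn0.
move: dD; rewrite -setI_eq0 setIUl setU_eq0 !setI_eq0 => /andP[dQD dBD].
have cDB : #|D :|: B| = (#|D| + #|B|)%N.
  by rewrite cardsU setIC disjoint_setI0 // cards0 subn0.
have U := card_imgU A D B.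
have i0 := img_gt0 A B; have i1 := img_gt0 A D.
rewrite cQB expnD in hj *.
have [small|big] := leqP #|D :|: B| #|Q|.
  have /cQ : [disjoint Q & D :|: B] by rewrite -setI_eq0 setIUr setU_eq0 !setI_eq0 dQD.
  move=> /(_ j small); rewrite cDB => /(_ _)/[!addnA] h.
  have {h} h : (N * 2 ^ (j * r) <= L * 2 ^ #|Q| * #|img A (D :|: B)|)%N by apply: h; lia.
  rewrite -mulnA; apply: leq_trans (leq_mul (leqnn N') h) _.
  apply: (@leq_trans (N' * (L' * 2 ^ #|Q| * (#|img A D| * #|img A B|)))).
    by rewrite leq_mul2l leq_mul ?orbT // leq_mul.
  have -> : (N' * (L' * 2 ^ #|Q| * (#|img A D| * #|img A B|)) =
    N' * #|img A B| * (L' * 2 ^ #|Q| * #|img A D|))%N by lia.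
  have -> : (L' * (2 ^ #|Q| * 2 ^ #|B|) * #|img A D| =
    2 ^ #|B| * (L' * 2 ^ #|Q| * #|img A D|))%N by lia.
  by rewrite leq_mul2r NB orbT.
have d0 : [disjoint Q & set0] by rewrite disjoint_sym -setI_eq0 set0I.
have i00 : #|img A set0| = 1%N.
  by apply/eqP; rewrite eqn_leq img_gt0 andbT; have := card_img_le A set0; rewrite cards0.
have hQ j' : (j' = 0 \/ s * 4 ^ j' <= #|Q|)%N -> (N * 2 ^ (j' * r) <= L * 2 ^ #|Q|)%N.
  by move=> h; have := cQ set0 j' d0; rewrite cards0 addn0 i00 muln1; apply.
rewrite cDB in big.
case: j hj => [_|j [//|hj]].
  have := hQ 0%N (or_introl erefl); rewrite mul0n !muln1 => h.
  apply: (@leq_trans (2 ^ #|B| * (L * 2 ^ #|Q|))); last first.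
    by rewrite mulnC -!mulnA leq_mul // leq_mul2l leq_pmulr ?orbT.
  by apply: leq_mul => //; apply: leq_trans NB; rewrite leq_pmulr.
(* Since |D| <= |Q| + |B| and |B| <= |Q|, the total |Q| + |B| + |D| is at most 4 |Q|; this is why
   the base is 4. *)
have hj' : (s * 4 ^ j <= #|Q|)%N by rewrite expnS in hj; lia.
have hr : (2 ^ r <= #|img A (D :|: B)|)%N.
  by apply: large_img; rewrite cDB; rewrite expnS in hj; have := expn_gt0 4 j; nia.
have {hQ} h := hQ j (or_intror hj').
rewrite mulSn expnD.
apply: (@leq_trans (N' * #|img A B| * #|img A D| * (N * 2 ^ (j * r)))).
  have -> : (N' * N * (2 ^ r * 2 ^ (j * r)) = N' * 2 ^ r * (N * 2 ^ (j * r)))%N by lia.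
  apply: leq_mul => //; rewrite -mulnA leq_mul2l mulnC.
  by rewrite (leq_trans hr U) orbT.
apply: (@leq_trans (2 ^ #|B| * #|img A D| * (L * 2 ^ #|Q|))).
  by rewrite leq_mul // leq_mul2r NB orbT.
have -> : (L' * (2 ^ #|Q| * 2 ^ #|B|) * #|img A D| =
  2 ^ #|B| * #|img A D| * (L' * 2 ^ #|Q|))%N by lia.
by rewrite leq_mul2l leq_mul2r LL !orbT.
Qed.

(** Peeling off a smallest block first guarantees that it is no larger than the union of the blocks
    that remain. *)
Lemma cost_bound_bigcup m (q : 'I_m -> {set 'I_n}) (N L : 'I_m -> nat)
    (I : {set 'I_m}) :
  (forall i j, i != j -> [disjoint q i & q j]) ->
  (forall i, N i * #|img A (q i)| <= 2 ^ #|q i|)%N ->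
  (forall i, cost_bound (q i) (N i) (L i)) -> I != set0 ->
  cost_bound (\bigcup_(i in I) q i) (\prod_(i in I) N i) (\sum_(i in I) L i).
Proof.
move=> dq hN hc; have [p] := ubnP #|I|; elim: p I => // p IH I Ip I0.
have [i0 i0I i0min] : exists2 i, i \in I & forall j, j \in I -> (#|q i| <= #|q j|)%N.
  by have [i1 i1I] := set0Pn _ I0; case: (arg_minnP (fun i => #|q i|) i1I) => i; exists i.
rewrite (big_setD1 i0) //= (big_setD1 i0 (F := N)) //= (big_setD1 i0 (F := L)) //=.
have [I1|/[dup] /set0Pn[i1 i1I] I1] := eqVneq (I :\ i0) set0.
  by rewrite I1 !big_set0 setU0 muln1 addn0.
rewrite setUC; apply: (@cost_bound_setU _ _ _ (\sum_(i in I :\ i0) L i)) => //.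
- rewrite disjoint_sym; apply: bigcup_disjoint => i; rewrite !inE => /andP[ii0 _].
  by apply: dq; rewrite eq_sym.
- move: (i1I); rewrite !inE => /andP[_ /i0min h]; apply: leq_trans h _.
  by apply: subset_leq_card; apply: bigcup_sup.
- exact: leq_addl.
apply: IH => //; move: Ip; rewrite (cardsD1 i0) i0I; lia.
Qed.

Lemma cost_bound_bigcupT m (q : 'I_m -> {set 'I_n}) (N L : 'I_m -> nat) :
  (0 < m)%N -> (forall i j, i != j -> [disjoint q i & q j]) ->
  (forall i, N i * #|img A (q i)| <= 2 ^ #|q i|)%N ->
  (forall i, cost_bound (q i) (N i) (L i)) ->
  cost_bound (\bigcup_i q i) (\prod_i N i) (\sum_i L i).
Proof.
move=> m0 dq hN hc.
have T0 : [set: 'I_m] != set0 by apply/set0Pn; exists (Ordinal m0).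
have := cost_bound_bigcup dq hN hc T0.
rewrite (eq_bigl _ _ (in_setT (T := _))) (eq_bigl _ N (in_setT (T := _))).
by rewrite (eq_bigl _ L (in_setT (T := _))).
Qed.

End CostBound.

(** * Supports of quantum state trees *)

Section TreeBound.
Variables (R : realType) (n : nat).
Implicit Types (t : qtree R n) (Q : {set 'I_n}) (x y z : bits n).

Definition supp t : {set bits n} := [set x in basis (qubits t) | amp t x != 0].

Lemma in_supp t x : (x \in supp t) = (x \in basis (qubits t)) && (amp t x != 0).
Proof. by rewrite inE. Qed.

Lemma amp_Tensor Q m (w : 'I_m -> qtree R n) x :
  amp (Tensor Q w) x = \prod_j amp (w j) x.
Proof. by []. Qed.

Lemma supp_neq0 t : normalized t -> supp t != set0.
Proof.
move=> nt; apply/set0Pn; apply: contrapT => none.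
have := @oner_neq0 R[i]; rewrite -nt big1 ?eqxx // => x xQ.
have [->|ax] := eqVneq (amp t x) 0; first by rewrite normr0 expr0n.
by case: none; exists x; rewrite in_supp xQ.
Qed.

(** Where one child is nonzero all the others vanish, so nothing can cancel it. *)
Lemma supp_child Q m (a : 'I_m -> R[i]) w j :
  (forall i, qubits (w i) = Q) -> disjoint_children (Plus Q a w) ->
  a j != 0 -> supp (w j) \subset supp (Plus Q a w).
Proof.
move=> qw dc aj; apply/subsetP => x; rewrite !in_supp /= qw => /andP[xQ ax].
rewrite xQ (bigD1 j) //= big1 => [|i ij]; first by rewrite addr0 mulf_neq0.
by have [->|aj0] := dc i j ij x xQ; [rewrite mulr0|rewrite aj0 eqxx in ax].
Qed.

Lemma card_supp_Plus Q m (a : 'I_m -> R[i]) w :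
  (forall i, qubits (w i) = Q) ->
  (#|supp (Plus Q a w)| <= \sum_(j | a j != 0%R) #|supp (w j)|)%N.
Proof.
move=> qw; apply: (@leq_trans #|\bigcup_(j | a j != 0) supp (w j)|); last first.
  elim/big_rec2: _ => [|j c U _ leUc]; first by rewrite cards0.
  by apply: leq_trans (leq_card_setU _ _) _; rewrite leq_add2l.
apply/subset_leq_card/subsetP => x; rewrite in_supp => /andP[/= xQ ax].
apply/bigcupP; apply: contrapT => none; case/eqP: ax; apply: big1 => j _.
have [->|aj] := eqVneq (a j) 0; first by rewrite mul0r.
have [->|awx] := eqVneq (amp (w j) x) 0; first by rewrite mulr0.
by case: none; exists j => //; rewrite in_supp qw xQ.
Qed.

Lemma partition_disjoint m (w : 'I_m -> qtree R n) Q i j :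
  well_labelled (Tensor Q w) -> i != j -> [disjoint qubits (w i) & qubits (w j)].
Proof.
move=> [_ inj /and3P[_ /trivIsetP tI _]] ij.
by apply: tI; rewrite ?imset_f // (inj_eq inj).
Qed.

Lemma bigcup_qubits m (w : 'I_m -> qtree R n) Q :
  well_labelled (Tensor Q w) -> \bigcup_j qubits (w j) = Q.
Proof. by move=> [_ _ /and3P[/eqP <- _ _]]; rewrite cover_imset. Qed.

Lemma supp_restrict m (w : 'I_m -> qtree R n) Q x j :
  every_vertex (@well_labelled R n) (Tensor Q w) ->
  x \in supp (Tensor Q w) -> Defs.restrict (qubits (w j)) x \in supp (w j).
Proof.
move=> [_ wl]; rewrite !in_supp => /andP[_ ax].
rewrite restrict_in_basis /=.
rewrite (@amp_local _ _ _ _ x) => [||i iq]; last by rewrite mxE iq.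
  by apply: contra_neq ax => a0 /=; rewrite (bigD1 j) //= a0 mul0r.
exact: wl.
Qed.

Lemma card_supp_Tensor m (w : 'I_m -> qtree R n) Q :
  every_vertex (@well_labelled R n) (Tensor Q w) ->
  (#|supp (Tensor Q w)| <= \prod_j #|supp (w j)|)%N.
Proof.
move=> wl; pose f x := [ffun j => Defs.restrict (qubits (w j)) x].
have -> : (\prod_j #|supp (w j)| = #|family (fun j => mem (supp (w j)))|)%N.
  by rewrite card_family foldrE big_map big_enum.
rewrite -(@card_in_imset _ _ f).
  apply/subset_leq_card/subsetP => _ /imsetP[x xs ->].
  by apply/familyP => j; rewrite ffunE; apply: supp_restrict xs.
move=> x y; rewrite !in_supp => /andP[/basisP xQ _] /andP[/basisP yQ _] /ffunP e.
apply/colP => i; case: (boolP (i \in Q)) => iQ; last by rewrite xQ // yQ.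
have := iQ; rewrite -(bigcup_qubits (proj1 wl)) => /bigcupP[j _ ij].
by have := e j; rewrite !ffunE => /colP/(_ i); rewrite !mxE ij.
Qed.

Definition splice Q z x : bits n := \col_i (if i \in Q then x i 0 else z i 0).

Lemma splice_supp m (w : 'I_m -> qtree R n) Q j z x :
  every_vertex (@well_labelled R n) (Tensor Q w) ->
  z \in supp (Tensor Q w) -> x \in supp (w j) ->
  splice (qubits (w j)) z x \in supp (Tensor Q w).
Proof.
move=> wl; rewrite !in_supp !amp_Tensor => /andP[/basisP zQ az] /andP[_ ax].
apply/andP; split.
  apply/basisP => i iQ; rewrite mxE ifN ?zQ //; apply: contra iQ => ij.
  by rewrite -(bigcup_qubits (proj1 wl)); apply/bigcupP; exists j.
apply/prodf_neq0 => i _; have [->|ij] := eqVneq i j.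
  rewrite (@amp_local _ _ _ _ x) //; first exact: (proj2 wl).
  by move=> l lj; rewrite mxE lj.
have dij := partition_disjoint (proj1 wl) ij.
rewrite (@amp_local _ _ _ _ z) //; first by move/prodf_neq0: az; apply.
  exact: (proj2 wl).
by move=> l li; rewrite mxE (disjointFr dij li).
Qed.

Section Coset.
Variables (k : nat) (A : 'M['F_2]_(k, n)) (s r : nat).
Hypothesis s_gt0 : (0 < s)%N.
Hypothesis large_img : forall B : {set 'I_n}, (s <= #|B|)%N -> (2 ^ r <= #|img A B|)%N.

Lemma tree_cost_bound t :
  every_vertex (@well_labelled R n) t -> every_vertex (@normalized R n) t ->
  manifestly_orthogonal t -> {in supp t &, forall x y, A *m x = A *m y} ->
  cost_bound A s r (qubits t) #|supp t| (leaves t).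
Proof.
rewrite /manifestly_orthogonal.
elim: t => [i al be|Q m a w IH|Q m w IH] wl nt mo cA.
- apply: cost_bound_leaf => //.
  apply: (@leq_trans #|basis [set i]|).
    by apply/subset_leq_card/subsetP => x; rewrite in_supp => /andP[].
  by have := card_basis_le [set i]; rewrite cards1.
- move: wl mo => [[_ qw] wl] [dc mo] D j dQD DQ hj /=.
  apply: (@leq_trans (\sum_(i | a i != 0%R) #|supp (w i)| * 2 ^ (j * r))).
    by rewrite -big_distrl leq_mul2r card_supp_Plus ?orbT.
  rewrite -mulnA big_distrl [leqRHS](bigID (fun i => a i != 0)) /=.
  apply: leq_trans (leq_addr _ _); apply: leq_sum => i ai.
  rewrite -(qw i) in dQD DQ hj *; rewrite mulnA; apply: IH => //.
  + exact: wl.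
  + exact: (proj2 nt).
  + exact: mo.
  + by move=> x y /(subsetP (supp_child qw dc ai)) xs /(subsetP (supp_child qw dc ai)); apply: cA.
- have [z zs] := set0Pn _ (supp_neq0 (proj1 nt)).
  (* With the other coordinates frozen at a support vector z, A of the spliced vector differs from A
     x by a constant, so each child also has its support in one coset. *)
  have cw j : {in supp (w j) &, forall x y, A *m x = A *m y}.
    have spl x : x \in supp (w j) ->
        A *m splice (qubits (w j)) z x = A *m x + A *m splice (qubits (w j)) z 0.
      rewrite in_supp => /andP[/basisP xb _]; rewrite -mulmxDr; congr (_ *m _).
      apply/colP => i; rewrite !mxE; case: ifPn => [_|/xb ->]; first by rewrite addr0.
      by rewrite add0r.
    move=> x y xs ys; have := cA _ _ (splice_supp wl zs xs) (splice_supp wl zs ys).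
    by rewrite (spl x) // (spl y) //; apply: addIr.
  have [m0 _ _] := proj1 wl.
  have cT : cost_bound A s r (\bigcup_i qubits (w i)) (\prod_i #|supp (w i)|)
      (\sum_i leaves (w i)).
    apply: (cost_bound_bigcupT s_gt0 large_img m0).
    + by move=> i l; apply: partition_disjoint (proj1 wl).
    + move=> i; apply: card_fiber_img (cw i).
      by apply/subsetP => x; rewrite in_supp => /andP[].
    + by move=> i; apply: IH; [exact: (proj2 wl)|exact: (proj2 nt)|exact: (proj2 mo)|].
  rewrite (bigcup_qubits (proj1 wl)) in cT.
  move=> D j dQD DQ hj; apply: leq_trans (cT D j dQD DQ hj).
  by rewrite leq_mul2r card_supp_Tensor ?orbT.
Qed.

End Coset.
End TreeBound.

(** * From the kernel to a lower bound on [M] *)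

Section Kernel.
Variables (k n : nat) (A : 'M['F_2]_(k, n)).

Lemma card_bits m : #|{: bits m}| = (2 ^ m)%N.
Proof. by rewrite card_mx card_Fp // muln1. Qed.

Lemma card_solution_set : (2 ^ n <= #|solution_set A 0| * 2 ^ k)%N.
Proof.
rewrite -(card_bits n) -(card_bits k) -[#|{: bits k}|]cardsT -cardsX.
pose lift v : bits n := odflt 0 [pick y | A *m y == v].
have liftK x : A *m lift (A *m x) = A *m x.
  by rewrite /lift; case: pickP => [z /eqP //|/(_ x)]; rewrite eqxx.
rewrite -(@card_imset _ _ (fun x : bits n => (x - lift (A *m x), A *m x))).
  apply/subset_leq_card/subsetP => _ /imsetP[x _ ->].
  by rewrite !inE /= mulmxBr liftK subrr eqxx.
by move=> x y [+ e]; rewrite e => /addIr.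
Qed.

End Kernel.

Section Leaves.
Variables (R : realType) (k n : nat) (A : 'M['F_2]_(k, n)) (s r : nat).
Hypothesis s_gt0 : (0 < s)%N.
Hypothesis large_img : forall B : {set 'I_n}, (s <= #|B|)%N -> (2 ^ r <= #|img A B|)%N.

Lemma leaves_lower_bound (t : qtree R n) j : state_tree t -> manifestly_orthogonal t ->
  represents t (@uniform_state R n (solution_set A 0)) -> (s * 4 ^ j <= n)%N ->
  (2 ^ (j * r) <= leaves t * 2 ^ k)%N.
Proof.
move=> [qT wl nt] mo rep hj.
have suppE : supp t = solution_set A 0.
  apply/setP => x; rewrite in_supp qT basisT in_setT rep /uniform_state.
  case: ifPn => [xC|_]; last by rewrite eqxx.
  rewrite eqE /= negb_and invr_eq0 sqrtr_eq0 -ltNge ltr0n.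
  by apply/orP; left; apply/card_gt0P; exists x.
have cA : {in supp t &, forall x y, A *m x = A *m y}.
  by move=> x y; rewrite suppE !inE => /eqP -> /eqP ->.
have := tree_cost_bound s_gt0 large_img wl nt mo cA.
rewrite qT => /(_ set0 j); rewrite cards0 cardsT card_ord addn0 suppE.
rewrite disjoint_sym -setI_eq0 set0I eqxx => /(_ isT isT (or_intror hj)).
have i0 : (#|img A set0| <= 1)%N by have := card_img_le A set0; rewrite cards0.
have := card_solution_set A; set C := #|_| => hC h.
have {}h : (C * 2 ^ (j * r) <= leaves t * 2 ^ n)%N.
  by apply: leq_trans h _; rewrite -[leqRHS]muln1 leq_mul.
have C0 : (0 < C)%N by apply/card_gt0P; exists 0; rewrite inE mulmx0.
rewrite -(leq_pmul2l C0); apply: leq_trans h _.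
by rewrite mulnCA leq_mul.
Qed.

Lemma MOTS_lower_bound j : (0 < n)%N -> (s * 4 ^ j <= n)%N ->
  (2 ^ (j * r) <= M R A * 2 ^ k)%N.
Proof.
move=> n0 hj; set psi := @uniform_state R n (solution_set A 0).
(* Norm one provides some tree, so [MOTS] is a true minimum and not its default value 0. *)
have norm1 : \sum_x `|psi x| ^+ 2 = 1.
  have C0 : (0 < #|solution_set A 0|)%N by apply/card_gt0P; exists 0; rewrite inE mulmx0.
  rewrite (bigID (mem (solution_set A 0))) /= [X in _ + X]big1 => [|x /negbTE xC].
    rewrite addr0 (eq_bigr (fun=> (#|solution_set A 0|%:R)^-1)) => [|x xC].
      by rewrite sumr_const -[LHS]mulr_natl divff // pnatr_eq0 -lt0n.
    rewrite /psi /uniform_state xC.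
    rewrite ger0_norm ?lecR ?invr_ge0 ?sqrtr_ge0 //.
    by rewrite -rmorphXn /= exprVn sqr_sqrtr ?ler0n // fmorphV /= rmorph_nat.
  by rewrite /psi /uniform_state xC normr0 expr0n.
have [s0 hs] := mot_exists n0 norm1.
rewrite /M /MOTS -/psi; case: pselect => [e|]; last by case; exists s0.
case: ex_minnP => l /asboolP[t [st mo rep <-]] _.
exact: leaves_lower_bound rep hj.
Qed.

End Leaves.

(** * Counting matrices with columns of low rank *)

(** A matrix of rank at most r is a product through dimension r; its rank factorization is padded
    with zeros to reach exactly r. *)
Lemma card_rank_le (F : finFieldType) k s r :
  (#|[set Y : 'M[F]_(k, s) | (\rank Y <= r)%N]| <= #|F| ^ (r * (k + s)))%N.
Proof.
have -> : (#|F| ^ (r * (k + s)) = #|[set: 'M[F]_(k, r) * 'M[F]_(r, s)]|)%N.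
  by rewrite cardsT card_prod !card_mx -expnD mulnDr (mulnC k).
apply: leq_trans (leq_imset_card (fun u : 'M[F]_(k, r) * 'M[F]_(r, s) => u.1 *m u.2) _).
apply/subset_leq_card/subsetP => Y; rewrite inE => rY.
apply/imsetP; exists (col_base Y *m pid_mx (\rank Y), pid_mx (\rank Y) *m row_base Y).
  by rewrite in_setT.
rewrite /= mulmxA -(mulmxA (col_base Y)) mul_pid_mx minnn (minn_idPr rY) pid_mx_1.
by rewrite mulmx1 mulmx_base.
Qed.

(** Exchanging the columns of A selected by f with a free matrix Z loses no information about the
    pair (A, Z). *)
Lemma card_colsub_rank_le (F : finFieldType) k n s r (f : 'I_s -> 'I_n) : injective f ->
  (#|[set A : 'M[F]_(k, n) | (\rank (colsub f A) <= r)%N]| * #|F| ^ (k * s) <=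
   #|F| ^ (r * (k + s)) * #|F| ^ (k * n))%N.
Proof.
move=> injf; set S := [set A | _].
apply: leq_trans (leq_mul (card_rank_le F k s r) (leqnn _)).
rewrite -(card_mx F k s) -(card_mx F k n) -[#|{: 'M[F]_(k, s)}|]cardsT.
rewrite -[#|{: 'M[F]_(k, n)}|]cardsT -!cardsX.
pose rep (A : 'M[F]_(k, n)) (Z : 'M[F]_(k, s)) : 'M[F]_(k, n) :=
  \matrix_(i, j) oapp (Z i) (A i j) [pick l | f l == j].
have repf A Z i l : rep A Z i (f l) = Z i l.
  rewrite mxE; case: pickP => [l' /eqP/injf -> //|/(_ l)]; by rewrite eqxx.
have repNf A Z i j : (forall l, f l != j) -> rep A Z i j = A i j.
  by move=> fj; rewrite mxE; case: pickP => [l'|//]; rewrite (negbTE (fj _)).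
rewrite -(@card_imset _ _ (fun u => (colsub f u.1, rep u.1 u.2))).
  apply/subset_leq_card/subsetP => _ /imsetP[[A Z] /setXP[/= + _] ->].
  by rewrite inE => rA; rewrite !inE /= rA.
move=> [A Z] [A' Z'] /= [/matrixP eA /matrixP eR]; congr pair; apply/matrixP => i j.
  have [/existsP[l /eqP <-]|] := boolP [exists l, f l == j].
    by have := eA i l; rewrite !mxE.
  by rewrite negb_exists => /forallP h; have := eR i j; rewrite !repNf.
by have := eR i (f j); rewrite !repf.
Qed.

Definition has_degenerate_columns (F : fieldType) k n s r (A : 'M[F]_(k, n)) : bool :=
  [exists f : {ffun 'I_s -> 'I_n}, injectiveb f && (\rank (colsub f A) <= r)%N].

Lemma card_degenerate (F : finFieldType) k n s r :
  (#|[set A : 'M[F]_(k, n) | has_degenerate_columns s r A]| * #|F| ^ (k * s) <=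
   n ^ s * (#|F| ^ (r * (k + s)) * #|F| ^ (k * n)))%N.
Proof.
pose B (f : {ffun 'I_s -> 'I_n}) := [set A : 'M[F]_(k, n) | (\rank (colsub f A) <= r)%N].
apply: (@leq_trans ((\sum_(f : {ffun 'I_s -> 'I_n} | injectiveb f) #|B f|) * #|F| ^ (k * s))).
  rewrite leq_mul2r; apply/orP; right.
  apply: (@leq_trans #|\bigcup_(f : {ffun 'I_s -> 'I_n} | injectiveb f) B f|).
    apply/subset_leq_card/subsetP => A; rewrite inE => /existsP[f /andP[injf rf]].
    by apply/bigcupP; exists f => //; rewrite inE.
  elim/big_rec2: _ => [|f c U _ leUc]; first by rewrite cards0.
  by apply: leq_trans (leq_card_setU _ _) _; rewrite leq_add2l.
rewrite big_distrl /=.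
apply: (@leq_trans (\sum_(f : {ffun 'I_s -> 'I_n} | injectiveb f)
    (#|F| ^ (r * (k + s)) * #|F| ^ (k * n)))).
  by apply: leq_sum => f /injectiveP; apply: card_colsub_rank_le.
rewrite sum_nat_const leq_mul2r; apply/orP; right.
by rewrite -[n in (n ^ s)%N]card_ord -[s in (_ ^ s)%N]card_ord -card_ffun max_card.
Qed.

(** The span of s columns of A with indices in B lies in [img A B] and has 2 to the power of its
    rank elements. *)
Lemma img_nondegenerate k n (A : 'M['F_2]_(k, n)) s r (B : {set 'I_n}) :
  ~~ has_degenerate_columns s r A -> (s <= #|B|)%N -> (2 ^ r <= #|img A B|)%N.
Proof.
rewrite negb_exists => /forallP ndeg sB.
pose f : {ffun 'I_s -> 'I_n} := [ffun i => enum_val (widen_ord sB i)].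
have injf : injective f.
  by move=> i j; rewrite !ffunE => /enum_val_inj/(congr1 val) /= /val_inj.
have := ndeg f; rewrite (introT (injectiveP _) injf) /= -ltnNge => /ltnW rf.
set Y := colsub f A in rf.
apply: (@leq_trans (2 ^ \rank Y)); first by rewrite leq_exp2l.
rewrite -(card_bits (\rank Y)) -(card_imset _ (row_full_inj (col_base_full Y) (p := 1))).
apply/subset_leq_card/subsetP => _ /imsetP[y _ ->].
(* [pinvmx (row_base Y)] is a right inverse of [row_base Y], and [colsub f 1%:M] places the
   coefficients at the positions selected by f, all in B. *)
apply/imsetP; exists (colsub f 1%:M *m (pinvmx (row_base Y) *m y)).
  apply/basisP => i iB; rewrite mxE big1 // => l _; rewrite !mxE.
  case: eqP => [e|_]; last by rewrite mul0r.
  by case/negP: iB; rewrite e ffunE enum_valP.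
rewrite (mulmxA A) mulmx_colsub mulmx1 -/Y -[X in X *m (pinvmx _ *m _)](mulmx_base Y).
by rewrite -mulmxA (mulmxA (row_base Y)) mulmxVp ?row_base_free // mul1mx.
Qed.

Lemma PrA_ge_half (R : realType) k n (E : pred 'M['F_2]_(k, n)) :
  (2 * #|[set A | ~~ E A]| <= 2 ^ (k * n))%N -> 2^-1 <= PrA R E.
Proof.
move=> h; rewrite /PrA.
have F2 : #|{: 'F_2}| = 2%N by rewrite card_Fp.
rewrite F2; under eq_bigr => A _ do rewrite !prodr_const !card_ord -exprM.
rewrite sumr_const.
have cE : (#|[set A | ~~ E A]| + #|E| = 2 ^ (k * n))%N.
  have := card_mx 'F_2 k n; rewrite F2 => <-.
  rewrite -(cardC E) addnC; congr (_ + _)%N; apply: eq_card => A; by rewrite !inE.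
rewrite -[leRHS]mulr_natl exprVn ler_pdivlMr ?exprn_gt0 ?ltr0n //.
rewrite mulrC ler_pdivrMr ?ltr0n // -natrX -natrM ler_nat.
rewrite -cE mul2n -addnn leq_add2l in h.
by rewrite (mulnC n) muln2 -addnn -cE leq_add2r.
Qed.

(* Taking fourth powers avoids rounding n <= 2^(k/4). *)
Lemma half_nondegenerate k n : (2 <= k)%N -> (n ^ 4 <= 2 ^ k)%N ->
  (2 * #|[set A : 'M['F_2]_(k, n) | has_degenerate_columns k (k %/ 4) A]| <= 2 ^ (k * n))%N.
Proof.
move=> k2 hn; set r := (k %/ 4)%N.
have := card_degenerate 'F_2 k n k r; rewrite card_Fp //; set D := #|_| => hD.
(* The factors are at most 2^(k^2 / 4) and 2^(k^2 / 2), and k >= 2 leaves room for the factor 2. *)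
have hr : (2 * (n ^ k * 2 ^ (r * (k + k))) <= 2 ^ (k * k))%N.
  rewrite -(@leq_exp2r _ _ 4) // !expnMn -!expnM.
  apply: (@leq_trans (2 ^ 4 * (2 ^ (k * k) * 2 ^ (2 * k * k)))).
    rewrite leq_mul // leq_mul //; last by rewrite leq_exp2l // /r; nia.
    by rewrite (mulnC k 4) expnM [leqRHS]expnM leq_exp2r; lia.
  by rewrite -!expnD leq_exp2l //; nia.
rewrite -(@leq_pmul2r (2 ^ (k * k))) ?expn_gt0 //.
rewrite -mulnA; apply: (@leq_trans (2 * (n ^ k * (2 ^ (r * (k + k)) * 2 ^ (k * n))))).
  by rewrite leq_mul2l hD.
by rewrite (mulnA (n ^ k)%N) mulnA mulnC leq_mul2l hr orbT.
Qed.

(** * Real-valued ranges and the choice of constants *)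

Lemma logarithmic_range (R : realType) n k : (0 < n)%N ->
  4 * log2 (n%:R : R) <= k%:R -> (n ^ 4 <= 2 ^ k)%N.
Proof.
move=> n0; rewrite /log2 mulrA ler_pdivrMr; last by rewrite ln_gt0 // ltr1n.
move=> h; rewrite -(ler_nat R) !natrX.
rewrite -ler_ln ?posrE ?exprn_gt0 ?ltr0n // !lnXn ?ltr0n //.
by rewrite -[leLHS]mulr_natl -[leRHS]mulr_natl.
Qed.

Lemma square_root_range (R : realType) n k :
  k%:R <= 2^-1 * Num.sqrt (n%:R * ln 2 : R) -> (k * k <= n)%N.
Proof.
move=> h; rewrite -(ler_nat R) natrM.
have ln2 : ln 2 < 2 :> R by apply: ln_sublinear; rewrite ltr0n.
have ln20 : 0 < ln 2 :> R by rewrite ln_gt0 // ltr1n.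
have sq : k%:R * k%:R <= (2^-1 * Num.sqrt (n%:R * ln 2)) * (2^-1 * Num.sqrt (n%:R * ln 2)) :> R.
  by rewrite ler_pM.
apply: le_trans sq _; rewrite mulrACA -expr2 -expr2 sqr_sqrtr; last by rewrite mulr_ge0 ?ler0n // ltW.
have n0 : 0 <= n%:R :> R by rewrite ler0n.
have : n%:R * ln 2 <= n%:R * 2 :> R by rewrite ler_wpM2l // ltW.
move=> hle; lra.
Qed.

Lemma powR_le_of_doubling (R : realType) (n k j m : nat) :
  (4 <= k)%N -> (17 <= j)%N -> (n < k * 4 ^ j.+1)%N ->
  (2 ^ (j * (k %/ 4)) <= m * 2 ^ k)%N ->
  (n%:R / k%:R ^+ 2) `^ (32^-1 * k%:R) <= m%:R :> R.
Proof.
move=> k4 j17 nj hm; have k0 : (0 < k%:R :> R) by rewrite ltr0n; lia.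
(* The hypothesis bounds n/k already; the second division by k only helps. *)
have step : n%:R / k%:R ^+ 2 <= 4 ^+ j.+1 :> R.
  rewrite ler_pdivrMr ?exprn_gt0 // -!natrX -natrM ler_nat; nia.
apply: (@le_trans _ _ ((4 ^+ j.+1) `^ (32^-1 * k%:R) : R)).
  apply: ge0_ler_powR => //; rewrite ?nnegrE ?divr_ge0 ?exprn_ge0 ?ler0n //.
  by rewrite mulr_ge0 ?invr_ge0 ?ler0n.
have -> : 4 ^+ j.+1 = 2 `^ (2 * j.+1)%:R :> R.
  have -> : 4 = 2 ^+ 2 :> R by rewrite -natrX.
  by rewrite powR_mulrn ?ler0n // exprM.
rewrite -powRrM.
have {}hm : 2 `^ (j * (k %/ 4))%:R <= m%:R * 2 `^ k%:R :> R.
  by rewrite !powR_mulrn ?ler0n // -!natrX -natrM ler_nat.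
rewrite -(@ler_pM2r _ (2 `^ k%:R)) ?powR_gt0 ?ltr0n // -powRD; last by rewrite pnatr_eq0 implybT.
apply: le_trans hm; apply: ler_powR; first by rewrite ler1n.
(* This is (j + 1) k / 16 + k <= j r with denominators cleared, where 1/16 is twice the exponent
   constant 1/32. As k >= 4 gives k <= 8 r, it reduces to 8 (j + 17) <= 16 j, that is, j >= 17. *)
have : ((j.+1 + 16) * k <= 16 * (j * (k %/ 4)))%N.
  have : (k <= 8 * (k %/ 4))%N by lia.
  nia.
rewrite -(ler_nat R) !natrM !natrD; set q : R := (k %/ 4)%:R.
move=> hle; lra.
Qed.

Theorem theorem31 (R : realType) :
  exists c c' : R, [/\ 0 < c, 0 < c' &
    exists N : nat, forall n k : nat, (N <= n)%N ->
      4 * log2 (n%:R : R) <= k%:R ->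
      k%:R <= 2^-1 * Num.sqrt (n%:R * ln 2 : R) ->
      c' <= PrA R (fun A : 'M['F_2]_(k, n) =>
              ((n%:R / k%:R ^+ 2) `^ (c * k%:R) : R) <= (M R A)%:R)].
Proof.
exists 32^-1, 2^-1; split; rewrite ?invr_gt0 ?ltr0n //.
(* Together with k^2 <= n, a threshold that is the square of 4^18 gives k * 4^18 <= n, which forces
   j >= 17 below. *)
exists (4 ^ 18 * 4 ^ 18)%N => n k nN hlog hsqrt.
have w1 : (4 ^ 1 <= 4 ^ 18)%N by rewrite leq_exp2l.
have w17 : (4 ^ 17 <= 4 ^ 18)%N by rewrite leq_exp2l.
rewrite expn1 in w1; move: (4 ^ 18)%N w1 w17 nN => w w1 w17 nN.
have n0 : (0 < n)%N by nia.
have {}hlog := logarithmic_range n0 hlog; have {}hsqrt := square_root_range hsqrt.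
have k4 : (4 <= k)%N.
  rewrite -(leq_exp2l _ _ (isT : 1 < 2)%N) ; apply: leq_trans hlog.
  by apply: (@leq_trans (2 ^ 4)) => //; rewrite leq_exp2r //; nia.
have kw : (k * 4 ^ 17 <= n)%N.
  apply: (@leq_trans (k * w)); first by rewrite leq_mul2l w17 orbT.
  by rewrite -leq_sqr; nia.
(* The largest j with k * 4^j <= n. *)
pose j := trunc_log 4 (n %/ k).
have q0 : (4 ^ 17 <= n %/ k)%N by rewrite leq_divRL ?(mulnC _ k) //; lia.
have qgt0 : (0 < n %/ k)%N by apply: leq_trans q0; rewrite expn_gt0.
have jn : (k * 4 ^ j <= n)%N by rewrite mulnC -leq_divRL ?trunc_logP //; lia.
have nj : (n < k * 4 ^ j.+1)%N by rewrite mulnC -ltn_divLR ?trunc_log_ltn //; lia.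
have j17 : (17 <= j)%N by rewrite trunc_log_max.
apply: PrA_ge_half; apply: leq_trans (half_nondegenerate _ hlog); last by lia.
rewrite leq_mul2l /=; apply/subset_leq_card/subsetP => A; rewrite !inE.
apply: contraR => ndeg; apply: (@powR_le_of_doubling R n k j (M R A) k4 j17 nj).
apply: (@MOTS_lower_bound _ _ _ _ k) => //; first by lia.
by move=> B; apply: img_nondegenerate.
Qed.
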